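(* Let $\mathcal{A}$ be a complex Banach algebra with unity, $a,b\in\mathcal{A}$ and $k$ a positive integer. Suppose $\alpha_{1}\alpha_{2}\cdots\alpha_{k}ab=0$ for all $\alpha_{1},\dots,\alpha_{k}\in\{a,b\}$. Then $a$ and $b$ are both g$\pi$-Hirano invertible if and only if $a+b$ is g$\pi$-Hirano invertible.
   Context: $\mathcal{A}^{qnil}$ denotes the set of quasinilpotent elements of $\mathcal{A}$ (spectrum equal to $\{0\}$). An element $a\in\mathcal{A}$ is g$\pi$-Hirano invertible if there exists $x\in\mathcal{A}$ with $xax=x$, $ax=xa$ and $a-a^{n+2}x\in\mathcal{A}^{qnil}$ for some positive integer $n$. *)

(* Defs.v *)
From HB Require Import structures.
From mathcomp Require Import all_boot all_order all_algebra.
From mathcomp Require Import all_classical all_reals all_analysis.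
From mathcomp Require Import complex.
Set Implicit Arguments. Unset Strict Implicit. Unset Printing Implicit Defensive.
Import Order.TTheory GRing.Theory Num.Theory.
Import numFieldNormedType.Exports.
Local Open Scope ring_scope.
Local Open Scope classical_set_scope.

(* A unital Banach algebra over a normed field K is a complete normed
   K-vector space A (library structure completeNormedModType K) equipped with
   a multiplication [mul] and a unit [one] making it an associative unital
   K-algebra, with submultiplicative norm.  (Hierarchy-Builder refuses to
   join the library's ring and normed-module hierarchies, so the algebra
   structure is given by explicit operations and axioms.) *)
Record is_banach_algebra (K : numFieldType) (A : completeNormedModType K)
    (mul : A -> A -> A) (one : A) : Prop := {
  ba_mulA : associative mul;
  ba_mul1l : left_id one mul;
  ba_mul1r : right_id one mul;
  ba_mulDl : left_distributive mul +%R;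
  ba_mulDr : right_distributive mul +%R;
  ba_mulZl : forall (c : K) (x y : A), mul (c *: x) y = c *: mul x y;
  ba_mulZr : forall (c : K) (x y : A), mul x (c *: y) = c *: mul x y;
  ba_normM : forall x y : A, `|mul x y| <= `|x| * `|y|;
  ba_one_neq0 : one != 0
}.

Section BanachDefs.
Variables (R : realType) (A : completeNormedModType R[i]).
Variables (mul : A -> A -> A) (one : A).

Definition ba_invertible (x : A) : Prop :=
  exists y : A, mul x y = one /\ mul y x = one.

Definition ba_pow (x : A) (n : nat) : A := iter n (mul x) one.

Definition ba_spectrum (a : A) : set R[i] :=
  [set lam : R[i] | ~ ba_invertible (lam *: one - a)].

Definition ba_qnil (a : A) : Prop := ba_spectrum a = [set 0].

Definition gpiHirano (a : A) : Prop :=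
  exists x : A, [/\ mul (mul x a) x = x, mul a x = mul x a &
    exists n : nat, (0 < n)%N /\ ba_qnil (a - mul (ba_pow a (n + 2)) x)].
End BanachDefs.

(* Main.v *)
(* Call [root_spectrum n a] the condition that every spectral value lam of a
   satisfies lam^(n+1) = lam. An element is gpi-Hirano invertible iff this holds
   for some n > 0, and the condition passes between (a, b) and c = a + b: for
   lam <> 0 the identities
     c^k (lam - a) (lam - b) = (lam - c) lam c^k,
     a^(k+1) (lam - c) = (lam - a) a^(k+1),  (lam - c) (c^k b) = (c^k b) (lam - b)
   give a one-sided inverse of lam - c, lam - a or lam - b. One-sided inverses
   suffice: if 1 - mu z is one-sided invertible for all mu, then z is
   quasinilpotent, because invertibility of 1 - t mu z is locally constant in t;
   this is applied to z = a - a^(n+1), where 1 - mu z splits into linear factors.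

   For the converse half of the spectral criterion, e = a^n is idempotent up to
   the quasinilpotent q = e - e^2, Newton's iteration p |-> 3 p^2 - 2 p^3 lifts e
   to an idempotent p, and x = a^(n-1) p (1 - p (1 - e))^-1 is the inverse sought.
   Convergence needs the spectral radius formula for quasinilpotent elements,
   obtained without complex analysis by averaging the resolvent over the roots of
   unity of order 2^j; it also yields 0 in the spectrum. *)
Require Import Defs.
From HB Require Import structures.
From mathcomp Require Import all_boot all_order all_algebra.
From mathcomp Require Import all_classical all_reals all_analysis.
From mathcomp Require Import complex ring lra.
Set Implicit Arguments. Unset Strict Implicit. Unset Printing Implicit Defensive.
Import Order.TTheory GRing.Theory Num.Theory.
Import numFieldNormedType.Exports.
Local Open Scope ring_scope.
Local Open Scope complex_scope.

Local Notation cnorm := Normc.normc.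

(** The norm is real-valued and lives on a genuine [algType], so that ring lemmas and polynomial
    evaluation apply; [renorm_banach] connects it with the given algebra. The value at 1 is not
    normalised, hence the factors [nrm 1] below. *)
Record banach_norm (R : realType) (B : algType R[i]) (nrm : B -> R) : Prop := {
  bnormD : forall x y, nrm (x + y) <= nrm x + nrm y;
  bnormM : forall x y, nrm (x * y) <= nrm x * nrm y;
  bnormZ : forall (c : R[i]) x, nrm (c *: x) = cnorm c * nrm x;
  bnorm_eq0 : forall x, nrm x = 0 -> x = 0;
  bnorm_complete : forall u : nat -> B,
    (forall eps : R, 0 < eps -> exists N : nat, forall m n : nat,
       (N <= m)%N -> (N <= n)%N -> nrm (u m - u n) < eps) ->
    exists l : B, forall eps : R, 0 < eps -> exists N : nat, forall n : nat,
       (N <= n)%N -> nrm (u n - l) < eps }.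

(** * One-sided and two-sided invertibility in a ring *)

Section Units.
Variable B : nzRingType.
Implicit Types x y z : B.

Definition invertible x := exists2 y, x * y = 1 & y * x = 1.
Definition rinvertible x := exists y, x * y = 1.
Definition linvertible x := exists y, y * x = 1.

Lemma rlinvertible x : rinvertible x -> linvertible x -> invertible x.
Proof.
move=> [y xy] [y' yx]; exists y => //.
by rewrite -[y]mul1r -yx -(mulrA y') xy mulr1 yx.
Qed.

Lemma invertible_r x : invertible x -> rinvertible x.
Proof. by case=> y; exists y. Qed.

Lemma invertible_l x : invertible x -> linvertible x.
Proof. by case=> y; exists y. Qed.

Lemma invertible1 : invertible 1.
Proof. by exists 1; rewrite mulr1. Qed.

Lemma rinvertibleM x y : rinvertible x -> rinvertible y -> rinvertible (x * y).
Proof.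
by case=> x' xx' [y' yy']; exists (y' * x'); rewrite mulrA -(mulrA x) yy' mulr1.
Qed.

Lemma linvertibleM x y : linvertible x -> linvertible y -> linvertible (x * y).
Proof.
by case=> x' xx' [y' yy']; exists (y' * x'); rewrite mulrA -(mulrA y') xx' mulr1.
Qed.

Lemma invertibleM x y : invertible x -> invertible y -> invertible (x * y).
Proof.
move=> ix iy; apply: rlinvertible.
  by apply: rinvertibleM; apply: invertible_r.
by apply: linvertibleM; apply: invertible_l.
Qed.

Lemma invertible_factor x y : GRing.comm x y -> invertible (x * y) -> invertible x.
Proof.
move=> cxy [z h1 h2]; apply: rlinvertible; first by exists (y * z); rewrite mulrA.
by exists (z * y); rewrite -mulrA -cxy.
Qed.

(** With [y] fixed, all [x] for which [x * y] is invertible are invertible together or not at all.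
    This carries invertibility from one parameter to nearby ones. *)
Lemma invertibleM_iff x y : invertible (x * y) -> invertible x <-> invertible y.
Proof.
case=> z h1 h2; split=> -[t t1 t2].
  apply: rlinvertible; last by exists (z * x); rewrite -mulrA.
  by exists (z * x); rewrite -[y]mul1r -t2 -!mulrA (mulrA x) (mulrA (x * y)) h1 mul1r.
apply: rlinvertible; first by exists (y * z); rewrite mulrA.
by exists (y * z); rewrite -[x]mulr1 -t1 !mulrA -(mulrA (y * z)) -(mulrA y z) h2 mulr1.
Qed.

Lemma comm_inv x y y' : y * y' = 1 -> y' * y = 1 -> GRing.comm x y -> GRing.comm x y'.
Proof.
move=> h1 h2 c; rewrite /GRing.comm.
by rewrite -[x * y']mul1r -h2 -mulrA (mulrA y) -c -(mulrA x) h1 mulr1.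
Qed.

Lemma sub1X_factor x n : exists2 g, 1 - x ^+ n = (1 - x) * g & GRing.comm (1 - x) g.
Proof.
exists (\sum_(i < n) x ^+ i).
  rewrite -[in LHS](expr1n B n) subrXX_comm; last exact/commr_sym/commr1.
  by congr (_ * _); apply: eq_bigr => i _; rewrite expr1n mul1r.
apply: commr_sum => i _; apply: commrX; apply/commr_sym.
by apply: commrB; [exact: commr1|].
Qed.

Lemma invertible_sub1X x n : invertible (1 - x ^+ n) -> invertible (1 - x).
Proof. by have [g -> c] := sub1X_factor x n; exact: invertible_factor. Qed.

End Units.

(** * Banach algebras *)

Section Norm.
Variables (R : realType) (B : algType R[i]) (nrm : B -> R).
Hypothesis nB : banach_norm nrm.
Implicit Types (x y z : B) (mu nu lam : R[i]).
Local Notation C := R[i].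

Lemma cnorm_real (t : R) : cnorm t%:C = `|t|.
Proof. by rewrite /= expr0n /= addr0 sqrtr_sqr. Qed.

Lemma cnormN (c : C) : cnorm (- c) = cnorm c.
Proof. exact: (@normcN R c). Qed.

Lemma cnorm_ge0 (c : C) : 0 <= cnorm c.
Proof. by case: c => a b; exact: sqrtr_ge0. Qed.

Lemma bnorm0 : nrm 0 = 0.
Proof. by rewrite -(scale0r (0 : B)) (bnormZ nB) Normc.normc0 mul0r. Qed.

Lemma bnormN x : nrm (- x) = nrm x.
Proof. by rewrite -scaleN1r (bnormZ nB) cnormN Normc.normc1 mul1r. Qed.

Lemma bnorm_ge0 x : 0 <= nrm x.
Proof. by have := bnormD nB x (- x); rewrite subrr bnorm0 bnormN; lra. Qed.

Lemma bnormB x y : nrm (x - y) <= nrm x + nrm y.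
Proof. by rewrite -(bnormN y); exact: bnormD nB _ _. Qed.

Lemma bnorm_distC x y : nrm (x - y) = nrm (y - x).
Proof. by rewrite -bnormN opprB. Qed.

Lemma bnorm_tri y x z : nrm (x - z) <= nrm (x - y) + nrm (y - z).
Proof. by have := bnormD nB (x - y) (y - z); rewrite addrA subrK. Qed.

Lemma bnorm1_ge1 : 1 <= nrm 1.
Proof.
have h : 0 < nrm 1.
  rewrite lt_neqAle bnorm_ge0 andbT eq_sym.
  by apply/eqP => /(bnorm_eq0 nB)/eqP; rewrite oner_eq0.
by have := bnormM nB 1 1; rewrite mulr1 ler_pMl.
Qed.

Lemma bnormX_le1 x n : nrm x <= 1 -> nrm (x ^+ n.+1) <= 1.
Proof.
move=> hx; elim: n => [//|n IH]; rewrite exprS.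
by apply: (le_trans (bnormM nB _ _)); rewrite mulr_ile1 ?bnorm_ge0.
Qed.

Lemma half_pow (K eps : R) : 0 < eps -> exists n : nat, K * 2^-1 ^+ n < eps.
Proof.
move=> e0; have [n hn] : exists n : nat, K / eps < n%:R.
  exists (Num.truncn `|K / eps|).+1; apply: le_lt_trans (ler_norm _) _.
  by rewrite -truncn_le_nat // truncn_lt_nat // .
exists n; rewrite exprVn ltr_pdivrMr ?exprn_gt0 //.
rewrite ltr_pdivrMr // in hn; apply: (lt_le_trans hn).
rewrite mulrC ler_pM2l //.
by rewrite -natrX ler_nat ltnW // ltn_expl.
Qed.

Lemma geometric_limit (u : nat -> B) (K : R) :
  (forall n, nrm (u n.+1 - u n) <= K * 2^-1 ^+ n) ->
  exists l, forall n, nrm (u n - l) <= 2 * K * 2^-1 ^+ n.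
Proof.
move=> hu.
have hp n : 0 < (2^-1 : R) ^+ n by rewrite exprn_gt0 // invr_gt0.
have K0 : 0 <= K.
  by have := hu 0%N; have := bnorm_ge0 (u 1%N - u 0%N); rewrite expr0; lra.
(* The subtracted power makes the induction close: each step adds exactly [K * 2^-1 ^+ (n + m)]. *)
have h1 n m : nrm (u (n + m)%N - u n) <= 2 * K * (2^-1 ^+ n - 2^-1 ^+ (n + m)).
  elim: m => [|m IH]; first by rewrite addn0 !subrr bnorm0 mulr0.
  apply: (le_trans (bnorm_tri (u (n + m)%N) _ _)).
  rewrite addnS; have := hu (n + m)%N; rewrite exprS.
  by move: IH; set a := _ ^+ _; set b := _ ^+ _; lra.
have h2 n m : (n <= m)%N -> nrm (u m - u n) <= 2 * K * 2^-1 ^+ n.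
  move=> nm; have := h1 n (m - n)%N; rewrite subnKC //.
  have := hp m; move=> h /le_trans; apply.
  by rewrite ler_wpM2l ?mulr_ge0 //; lra.
have [|l hl] := bnorm_complete nB (u := u).
  move=> e e0; have [N hN] := half_pow (4 * K) e0; exists N => m n Nm Nn.
  apply: (le_lt_trans (bnorm_tri (u N) _ _)); rewrite (bnorm_distC (u N)).
  by have := h2 _ _ Nm; have := h2 _ _ Nn; lra.
exists l => n; apply/ler_addgt0Pr => e e0.
have [N hN] := hl e e0; pose m := maxn N n.
apply: (le_trans (bnorm_tri (u m) _ _)); rewrite bnorm_distC.
have := hN m (leq_maxl _ _); have := h2 n m (leq_maxr _ _); lra.
Qed.

Lemma small_eq0 x (K : R) : (forall n : nat, nrm x <= K * 2^-1 ^+ n) -> x = 0.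
Proof.
move=> h; apply: (bnorm_eq0 nB); apply/eqP; rewrite eq_le bnorm_ge0 andbT.
apply/ler_addgt0Pr => e e0; have [n hn] := half_pow K e0.
by rewrite add0r; apply: (le_trans (h n)); exact: ltW.
Qed.

Lemma bnorm_half_pow x n : nrm x <= 2^-1 -> nrm (x ^+ n) <= nrm 1 * 2^-1 ^+ n.
Proof.
move=> hx; elim: n => [|n IH]; first by rewrite !expr0 mulr1.
rewrite exprS; apply: (le_trans (bnormM nB _ _)).
rewrite [_ ^+ n.+1]exprS mulrCA.
by apply: ler_pM => //; exact: bnorm_ge0.
Qed.

Lemma neumann x : nrm x <= 2^-1 ->
  exists y, [/\ (1 - x) * y = 1, y * (1 - x) = 1 & nrm y <= 2 * nrm 1].
Proof.
move=> hx; pose u n := \sum_(i < n) x ^+ i.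
have hp n : 0 < (2^-1 : R) ^+ n by rewrite exprn_gt0 // invr_gt0.
have [|l hl] := @geometric_limit u (nrm 1).
  by move=> n; rewrite /u big_ord_recr /= [_ + x ^+ n]addrC addrK; exact: bnorm_half_pow.
have h1 n : (1 - x) * u n = 1 - x ^+ n.
  rewrite -[in RHS](expr1n B n) subrXX_comm; last exact/commr_sym/commr1.
  by congr (_ * _); apply: eq_bigr => i _; rewrite expr1n mul1r.
have h2 n : u n * (1 - x) = 1 - x ^+ n.
  rewrite -h1; apply: commr_sym; apply: commr_sum => i _; apply: commrX.
  by apply/commr_sym; apply: commrB; [exact: commr1|].
exists l; split.
- apply/eqP; rewrite -subr_eq0; apply/eqP.
  apply: (@small_eq0 _ (nrm (1 - x) * (2 * nrm 1) + nrm 1)) => n.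
  have -> : (1 - x) * l - 1 = (1 - x) * (l - u n) - x ^+ n.
    by rewrite mulrBr h1 opprB addrA addrAC addrK.
  apply: (le_trans (bnormB _ _)); rewrite [leRHS]mulrDl; apply: lerD; last exact: bnorm_half_pow.
  apply: (le_trans (bnormM nB _ _)); rewrite -mulrA ler_wpM2l ?bnorm_ge0 //.
  by rewrite bnorm_distC hl.
- apply/eqP; rewrite -subr_eq0; apply/eqP.
  apply: (@small_eq0 _ (nrm (1 - x) * (2 * nrm 1) + nrm 1)) => n.
  have -> : l * (1 - x) - 1 = (l - u n) * (1 - x) - x ^+ n.
    by rewrite mulrBl h2 opprB addrA addrAC addrK.
  apply: (le_trans (bnormB _ _)); rewrite [leRHS]mulrDl; apply: lerD; last exact: bnorm_half_pow.
  apply: (le_trans (bnormM nB _ _)); rewrite mulrC -mulrA ler_wpM2l ?bnorm_ge0 //.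
  by rewrite bnorm_distC hl.
- by have := hl 0%N; rewrite /u big_ord0 sub0r bnormN expr0 mulr1.
Qed.

End Norm.

(** * Quasinilpotent elements *)

Section Resolvent.
Variables (R : realType) (B : algType R[i]) (nrm : B -> R).
Hypothesis nB : banach_norm nrm.
Implicit Types (x y z : B) (mu nu lam : R[i]).
Local Notation C := R[i].

(** Both [P] and its complement are open, and the real line is connected. *)
Lemma locally_constant (P : R -> Prop) :
  (forall t, exists2 d : R, 0 < d & forall s, `|s - t| < d -> (P t <-> P s)) ->
  forall s t, P s -> P t.
Proof.
move=> hP s t Ps.
have cT : connected (setT : set R) by apply/connected_intervalP => x y _ _ z _.
have op (Q : R -> Prop) : (forall t, exists2 d : R, 0 < d &
    forall s, `|s - t| < d -> (Q t <-> Q s)) -> open (Q : set R).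
  move=> hQ; rewrite openE => x Qx; have [d d0 hd] := hQ x.
  apply/nbhs_ballP; exists d => // y; rewrite /ball /= distrC => xy.
  exact/(hd y xy).
suff : (P : set R) = setT by move=> ->.
apply: cT; first by exists s.
  by exists P; [exact: op | rewrite setTI].
exists P; last by rewrite setTI.
rewrite -[P : set R]setCK; apply: open_closedC; apply: op => x.
have [d d0 hd] := hP x; exists d => // y xy; rewrite /setC /=.
by have := hd y xy; tauto.
Qed.

Lemma resolvent_perturb x y d : x * y = 1 -> y * x = 1 -> nrm (d * y) <= 2^-1 ->
  exists y', [/\ (x - d) * y' = 1, y' * (x - d) = 1 & nrm y' <= nrm y * (2 * nrm 1)].
Proof.
move=> xy yx /(neumann nB) [u [h1 h2 hu]].
have e : x - d = (1 - d * y) * x by rewrite mulrBl mul1r -mulrA yx mulr1.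
exists (y * u); split.
- by rewrite e -mulrA (mulrA x) xy mul1r.
- by rewrite e mulrA -(mulrA y) h2 mulr1.
- by apply: (le_trans (bnormM nB _ _)); rewrite ler_wpM2l // (bnorm_ge0 nB).
Qed.

(* The spectrum is contained in {0}; [qnil_not_invertible] makes it equal to {0}. *)
Definition qnil z := forall mu, invertible (1 - mu *: z).

Lemma small_scale (K : R) : 0 <= K -> exists2 d : R, 0 < d &
  forall s : R, `|s| <= d -> `|s| * K <= 2^-1.
Proof.
move=> K0; exists ((2 * (K + 1))^-1); first by rewrite invr_gt0; lra.
move=> s hs; apply: (le_trans (ler_wpM2r K0 hs)).
by rewrite invfM -mulrA ler_piMr ?invr_ge0 // ler_pdivrMl ?mulr1; lra.
Qed.

(** Moves along the segment from 0 to [mu]. If [y] is a one-sided inverse at parameter [t], its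
    product with the element at [s] is near 1, hence invertible, for [s] near [t]; by
    [invertibleM_iff] invertibility at [s] and at [t] both amount to that of [y]. *)
Lemma qnil_one_sided z :
  (forall mu, rinvertible (1 - mu *: z) \/ linvertible (1 - mu *: z)) -> qnil z.
Proof.
move=> hz mu; pose P t := invertible (1 - t%:C *: (mu *: z)).
suff : P 1 by rewrite /P scale1r.
apply: (@locally_constant P _ 0); last by rewrite /P scale0r subr0; exact: invertible1.
move=> t.
have eqd s : 1 - s%:C *: (mu *: z) = 1 - t%:C *: (mu *: z) - (s - t)%:C *: (mu *: z).
  by rewrite rmorphB scalerBl opprB addrA subrK.
have := hz (t%:C * mu); rewrite -scalerA => -[[y xy]|[y yx]].
- have [d d0 hd] := small_scale (bnorm_ge0 nB (mu *: z * y)).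
  exists d => // s /ltW st.
  have hs : invertible ((1 - s%:C *: (mu *: z)) * y).
    rewrite eqd mulrBl xy -scalerAl; have [|u [u1 u2 _]] := @neumann _ _ _ nB ((s - t)%:C *: (mu *: z * y)).
      by rewrite (bnormZ nB) cnorm_real; exact: hd.
    by exists u.
  have ht : invertible ((1 - t%:C *: (mu *: z)) * y) by rewrite xy; exact: invertible1.
  by rewrite /P (invertibleM_iff hs) (invertibleM_iff ht).
- have [d d0 hd] := small_scale (bnorm_ge0 nB (y * (mu *: z))).
  exists d => // s /ltW st.
  have hs : invertible (y * (1 - s%:C *: (mu *: z))).
    rewrite eqd mulrBr yx -scalerAr; have [|u [u1 u2 _]] := @neumann _ _ _ nB ((s - t)%:C *: (y * (mu *: z))).
      by rewrite (bnormZ nB) cnorm_real; exact: hd.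
    by exists u.
  have ht : invertible (y * (1 - t%:C *: (mu *: z))) by rewrite yx; exact: invertible1.
  by rewrite /P -(invertibleM_iff hs) -(invertibleM_iff ht).
Qed.

Lemma cnorm_le (a b : R) : cnorm (a +i* b) <= `|a| + `|b|.
Proof.
rewrite /= -[leRHS]ger0_norm ?addr_ge0 // -sqrtr_sqr ler_wsqrtr //.
rewrite sqrrD !real_normK ?num_real //.
by have := mulr_ge0 (normr_ge0 a) (normr_ge0 b); lra.
Qed.

Lemma Re_le_cnorm (c : C) : `|complex.Re c| <= cnorm c.
Proof.
case: c => a b /=; rewrite -[leLHS]sqrtr_sqr ler_wsqrtr //.
by rewrite lerDl sqr_ge0.
Qed.

Lemma Im_le_cnorm (c : C) : `|complex.Im c| <= cnorm c.
Proof.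
case: c => a b /=; rewrite -[leLHS]sqrtr_sqr ler_wsqrtr //.
by rewrite lerDr sqr_ge0.
Qed.

(** The disc lies in a compact square; [resolvent_perturb] bounds the inverses near each point, and
    compactness makes the bound uniform. *)
Lemma resolvent_bounded z (r : R) : qnil z -> exists2 M : R, 0 <= M &
  forall mu y, cnorm mu <= r -> y * (1 - mu *: z) = 1 -> nrm y <= M.
Proof.
move=> hz.
pose K : set (R * R) := (`[- r, r] `*` `[- r, r])%classic.
have cK : compact K by apply: compact_setX; exact: segment_compact.
pose P (M : R) (p : R * R) :=
  forall y, y * (1 - (p.1 +i* p.2) *: z) = 1 -> nrm y <= M.
have loc p : exists2 d : R, 0 < d & exists M : R, forall q,
    `|p.1 - q.1| < d -> `|p.2 - q.2| < d -> P M q.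
  have [y0 xy yx] := hz (p.1 +i* p.2).
  have [d d0 hd] := small_scale (bnorm_ge0 nB (z * y0)).
  exists (d / 2); first lra.
  exists (nrm y0 * (2 * nrm 1)) => q h1 h2 y hy.
  have [|y' [h3 h4 h5]] := @resolvent_perturb _ _ (((q.1 - p.1) +i* (q.2 - p.2)) *: z) xy yx.
    rewrite -scalerAl (bnormZ nB).
    have -> : cnorm ((q.1 - p.1) +i* (q.2 - p.2)) = `|cnorm ((q.1 - p.1) +i* (q.2 - p.2))|.
      by rewrite ger0_norm ?cnorm_ge0.
    apply: hd; rewrite ger0_norm ?cnorm_ge0 //; apply: (le_trans (cnorm_le _ _)).
    by rewrite distrC (distrC q.2); lra.
  have e : (p.1 +i* p.2) + ((q.1 - p.1) +i* (q.2 - p.2)) = (q.1 +i* q.2).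
    by apply/eqP; rewrite eq_complex /=; apply/andP; split; apply/eqP; lra.
  have e2 : 1 - (p.1 +i* p.2) *: z - ((q.1 - p.1) +i* (q.2 - p.2)) *: z = 1 - (q.1 +i* q.2) *: z.
    by rewrite -addrA -opprD -scalerDl e.
  rewrite e2 in h3; suff -> : y = y' by [].
  by rewrite -[y]mulr1 -h3 mulrA hy mul1r.
have [M0 [_ hM0]] : \forall M \near (+oo : set_system R), (K `<=` P M)%classic.
  apply: ((compact_near_coveringP K).1 cK R (pinfty_nbhs R) P _) => p Kp.
  have [d d0 [M hM]] := loc p.
  exists (ball p d, [set M' | M <= M']%classic) => /=.
    split; first exact: nbhsx_ballx.
    by exists M; split; [exact: num_real | move=> x /ltW].
  move=> [q M'] /= [[h1 h2] hM'] y hy; apply: (@le_trans _ _ M) => //.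
  exact: (hM q).
exists (Num.max 0 (M0 + 1)); first by rewrite le_max lexx.
move=> [a b] y hr hy; apply: (@le_trans _ _ (M0 + 1)); last by rewrite le_max lexx orbT.
apply: (hM0 (M0 + 1) _ (a, b)) => //; first lra.
have := le_trans (Re_le_cnorm _) hr; have := le_trans (Im_le_cnorm _) hr.
by rewrite /K /= !in_itv /= !ler_norml => /andP[? ?] /andP[? ?]; split; apply/andP; split; lra.
Qed.
End Resolvent.

(** * The spectral radius of a quasinilpotent element *)

Section SpectralRadius.
Variables (R : realType) (B : algType R[i]) (nrm : B -> R).
Hypothesis nB : banach_norm nrm.
Implicit Types (x y z : B) (mu nu lam : R[i]).
Local Notation C := R[i].

Lemma cnormX (c : C) n : cnorm (c ^+ n) = cnorm c ^+ n.
Proof.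
elim: n => [|n IH]; first by rewrite !expr0 Normc.normc1.
by rewrite !exprS Normc.normcM IH.
Qed.

Lemma root_minus1 n : (0 < n)%N -> exists2 zeta : C, zeta ^+ n = -1 & cnorm zeta = 1.
Proof.
move=> n0; exists (n.-root (-1)); first by rewrite rootCK.
apply/eqP; rewrite -(@pexpr_eq1 _ _ n) ?cnorm_ge0 // -cnormX rootCK //.
by rewrite cnormN Normc.normc1.
Qed.

Definition isinv x y := x * y = 1 /\ y * x = 1.

(** By the resolvent identity y - y' = (mu - nu) y z y' and the uniform bound on the inverses. *)
Lemma resolvent_lipschitz z : qnil z -> exists2 L : R, 0 <= L &
  forall mu nu y y', cnorm mu <= 1 -> cnorm nu <= 1 ->
  isinv (1 - mu *: z) y -> isinv (1 - nu *: z) y' ->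
  nrm (y - y') <= L * cnorm (mu - nu).
Proof.
move=> hz; have [M M0 hM] := resolvent_bounded nB 1 hz.
have z0 := bnorm_ge0 nB z.
exists (M * nrm z * M); first by rewrite !mulr_ge0.
move=> mu nu y y' hmu hnu [h1 h2] [h3 h4].
have -> : y - y' = (mu - nu) *: (y * z * y').
  have -> : y - y' = y * ((1 - nu *: z) - (1 - mu *: z)) * y'.
    by rewrite mulrBr mulrBl h2 mul1r -mulrA h3 mulr1.
  by rewrite opprB addrC addrA subrK -scalerBl -scalerAr -scalerAl.
rewrite (bnormZ nB) mulrC ler_wpM2r ?cnorm_ge0 //.
apply: (le_trans (bnormM nB _ _)); apply: ler_pM; rewrite ?(bnorm_ge0 nB) //; last exact: (hM nu).
apply: (le_trans (bnormM nB _ _)); apply: ler_pM; rewrite ?(bnorm_ge0 nB) //.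
exact: (hM mu).
Qed.

(* [1 - w^2 = (1 - w) (1 + w)] makes the inverse of [1 - w^2] the mean of the
   inverses of [1 - w] and [1 + w], and the latter is the former at a rotated
   parameter; so the Lipschitz constant does not grow with [j]. *)
Lemma resolvent_pow_lipschitz z : qnil z -> exists2 L : R, 0 <= L &
  forall j mu nu y y', cnorm mu <= 1 -> cnorm nu <= 1 ->
  isinv (1 - (mu *: z) ^+ (2 ^ j)) y -> isinv (1 - (nu *: z) ^+ (2 ^ j)) y' ->
  nrm (y - y') <= L * cnorm (mu - nu).
Proof.
move=> /resolvent_lipschitz[L L0 hL]; exists L => //; elim=> [|j IH] mu nu y y' hmu hnu.
  by rewrite expn0 !expr1; exact: hL.
have [zeta hz zeta1] := @root_minus1 (2 ^ j) (expn_gt0 2 j).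
have half w v : isinv (1 - w ^+ 2) v -> isinv (1 - w) (v * (1 + w)) /\ isinv (1 + w) (v * (1 - w)).
  move=> [h1 h2].
  have cwv : w * v = v * w.
    by apply: (comm_inv h1 h2); apply: commrB; [exact: commr1 | exact/commrX].
  have e1 : (1 + w) * (1 - w) = 1 - w ^+ 2 by rewrite mulrDl mul1r mulrBr mulr1 addrA subrK.
  have e2 : (1 - w) * (1 + w) = 1 - w ^+ 2 by rewrite mulrBl mul1r mulrDr mulr1 opprD addrA addrK.
  have c1 : (1 + w) * v = v * (1 + w) by rewrite mulrDl mulrDr cwv mul1r mulr1.
  have c2 : (1 - w) * v = v * (1 - w) by rewrite mulrBl mulrBr cwv mul1r mulr1.
  by split; split; rewrite ?mulrA ?c1 ?c2 -?mulrA ?e1 ?e2.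
have rot lam : ((zeta * lam) *: z) ^+ (2 ^ j) = - (lam *: z) ^+ (2 ^ j).
  by rewrite -scalerA exprZn hz scaleN1r.
rewrite expnSr !exprM => /half[h1 h2] /half[h3 h4].
have i1 := IH _ _ _ _ hmu hnu h1 h3.
have i2 : nrm (y * (1 - (mu *: z) ^+ (2 ^ j)) - y' * (1 - (nu *: z) ^+ (2 ^ j))) <= L * cnorm (mu - nu).
  have -> : cnorm (mu - nu) = cnorm (zeta * mu - zeta * nu).
    by rewrite -mulrBr Normc.normcM zeta1 mul1r.
  by apply: (IH); rewrite ?Normc.normcM ?zeta1 ?mul1r // rot opprK.
have -> : y - y' = 2^-1 *: ((y * (1 + (mu *: z) ^+ (2 ^ j)) - y' * (1 + (nu *: z) ^+ (2 ^ j)))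
   + (y * (1 - (mu *: z) ^+ (2 ^ j)) - y' * (1 - (nu *: z) ^+ (2 ^ j)))).
  have e (u w : B) : u = 2^-1 *: (u * (1 + w) + u * (1 - w)).
    by rewrite -mulrDr addrACA subrr addr0 mulrDr mulr1 -[u + u]mulr2n -[u *+ 2]scaler_nat scalerA mulVf ?scale1r // pnatr_eq0.
  by rewrite [in LHS](e y ((mu *: z) ^+ (2 ^ j))) [in LHS](e y' ((nu *: z) ^+ (2 ^ j))) -scalerBr opprD addrACA.
rewrite (bnormZ nB).
have -> : cnorm (2^-1 : C) = 2^-1.
  by have := @cnorm_real R 2^-1; rewrite fmorphV rmorph_nat => ->; rewrite ger0_norm ?invr_ge0.
rewrite ler_pdivrMl //; apply: (le_trans (bnormD nB _ _)); lra.
Qed.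

Lemma pow2_decay x j k : nrm (x ^+ (2 ^ j)) <= 2^-1 -> nrm (x ^+ (2 ^ (j + k))) <= 2^-1 ^+ k.+1.
Proof.
move=> hx; elim: k => [|k IH]; first by rewrite addn0 expr1.
rewrite addnS expnSr exprM expr2; apply: (le_trans (bnormM nB _ _)).
rewrite [leRHS]exprS; apply: ler_pM; rewrite ?(bnorm_ge0 nB) //.
by apply: (le_trans IH); rewrite exprS ler_piMr ?invr_ge0 // exprn_ile1 ?invr_ge0 // invf_le1 // ler1n.
Qed.

(** Applied to all scalar multiples of [z], this says that the spectral radius is 0; [qnil_of_small]
    is the converse. *)
Lemma qnil_pow_small z : qnil z -> exists j, nrm (z ^+ (2 ^ j)) <= 2^-1.
Proof.
move=> hz; have [L L0 hL] := resolvent_pow_lipschitz hz.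
have n1 := bnorm1_ge1 nB.
(* Induction on [j]: 1 - w^2 = (1 - w)(1 + w), and 1 + w is 1 - w at the parameter rotated by a root
   of -1. *)
have inv_pow (mu : C) j : exists y, isinv (1 - (mu *: z) ^+ (2 ^ j)) y.
  elim: j mu => [|j IH] mu.
    by have [y h1 h2] := hz mu; exists y; rewrite expn0 expr1.
  have [zeta hzeta _] := @root_minus1 (2 ^ j) (expn_gt0 2 j).
  have [y1 [h1 h2]] := IH mu; have [y2] := IH (zeta * mu).
  rewrite -scalerA exprZn hzeta scaleN1r opprK => -[h3 h4].
  set w := (mu *: z) ^+ (2 ^ j) in h1 h2 h3 h4 *.
  have i1 : invertible (1 - w) by exists y1.
  have i2 : invertible (1 + w) by exists y2.
  have [t t1 t2] := invertibleM i1 i2.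
  exists t; rewrite expnSr exprM -/w.
  have <- : (1 - w) * (1 + w) = 1 - w ^+ 2 by rewrite mulrBl mul1r mulrDr mulr1 opprD addrA addrK.
  by [].
(* If the powers at parameter [t] are eventually small, the inverses of
   [1 - (t z)^(2^j)] are close to 1, and so are those at [t + d] by the Lipschitz
   bound; finitely many such steps lead from 0 to 1. *)
pose E (t : R) := exists j, nrm ((t%:C *: z) ^+ (2 ^ j)) <= 2^-1.
have step (t d : R) : 0 <= t -> 0 <= d -> t + d <= 1 -> L * d <= 6^-1 -> E t -> E (t + d).
  move=> t0 d0 td Ld [j hj].
  (* The Neumann inverse has norm at most [2 * nrm 1], so this choice gives nrm (y' - 1) <= 1/6. The
     Lipschitz bound adds 1/6, so nrm (y - 1) <= 1/3, and v = (y - 1) - (y - 1) v then forces nrm v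
     <= 1/2. *)
  have [k hk] := @half_pow _ (2^-1) (12 * nrm 1)^-1 ltac:(rewrite invr_gt0; lra).
  have := pow2_decay k hj; rewrite exprS => hw.
  set i := (j + k)%N in hw *; exists i.
  have [y hy] := inv_pow (t + d)%:C i; have [y' hy'] := inv_pow t%:C i.
  have := hL i _ _ _ _ _ _ hy hy'; rewrite -rmorphB !cnorm_real addrAC subrr add0r.
  rewrite !ger0_norm // ?addr_ge0 // => /(_ td ltac:(lra)) hyy.
  set w := (t%:C *: z) ^+ _ in hw hy'; set v := (_ *: z) ^+ _ in hy *.
  have hw2 : nrm w <= (12 * nrm 1)^-1 by apply: (le_trans hw); exact: ltW.
  have hw3 : nrm w <= 2^-1.
    apply: (le_trans hw2); rewrite lef_pV2 ?posrE; lra.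
  have [u [u1 u2 hu]] := neumann nB hw3.
  have yu : y' = u by rewrite -[y']mulr1 -u1 mulrA (hy'.2) mul1r.
  have h1 : nrm (y' - 1) <= 6^-1.
    have -> : y' - 1 = y' * w by rewrite -[X in _ - X](hy'.2) mulrBr mulr1 subKr.
    rewrite yu; apply: (le_trans (bnormM nB _ _)).
    have := ler_pM (bnorm_ge0 nB u) (bnorm_ge0 nB w) hu hw2.
    rewrite invfM mulrACA mulfV ?mulr1; last by rewrite gt_eqF //; lra.
    by move=> /le_trans; apply; lra.
  have h2 : nrm (y - 1) <= 3^-1.
    by apply: (le_trans (bnorm_tri nB y' _ _)); lra.
  have h3 : v = (y - 1) - (y - 1) * v.
    have := hy.2; rewrite mulrBr mulr1 => e.
    by rewrite mulrBl mul1r opprB addrC -addrA [- _ + (_ - _)]addrA [- _ + y]addrC e subrr addr0.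
  have := bnormB nB (y - 1) ((y - 1) * v); rewrite -h3.
  have := bnormM nB (y - 1) v.
  have := ler_wpM2r (bnorm_ge0 nB v) h2; lra.
(* Steps of length 1/N satisfy the requirement [L * d <= 6^-1]. *)
pose N := (Num.truncn (6 * L)).+1.
have hN : 6 * L < N%:R by rewrite -truncn_lt_nat // mulr_ge0.
have N0 : 0 < N%:R :> R by rewrite ltr0n.
have all_i i : (i <= N)%N -> E (i%:R / N%:R).
  elim: i => [_|i IH iN]; first by exists 0%N; rewrite mul0r scale0r expr1 (bnorm0 nB) invr_ge0.
  rewrite -addn1 natrD mulrDl; apply: step; rewrite ?divr_ge0 ?ler0n //.
  - by rewrite -mulrDl -natrD addn1 ler_pdivrMr // mul1r ler_nat.
  - by rewrite mul1r ler_pdivrMr // ; lra.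
  - by apply: IH; exact: ltnW.
by have := all_i N (leqnn N); rewrite mulfV ?gt_eqF // => -[j]; rewrite scale1r; exists j.
Qed.

Lemma qnil_of_small z : (forall mu, exists n, nrm ((mu *: z) ^+ n) <= 2^-1) -> qnil z.
Proof.
move=> h mu; have [n hn] := h mu; apply: (@invertible_sub1X _ _ n).
by have [y [h1 h2 _]] := neumann nB hn; exists y.
Qed.

Lemma qnilZ c z : qnil z -> qnil (c *: z).
Proof. by move=> hz mu; rewrite scalerA. Qed.

(** Rescaling [y] to norm at most 1 moves its size into the scalar in front of [z]; the powers of
    the product are then as small as those of a multiple of [z]. *)
Lemma qnilM z y : qnil z -> GRing.comm z y -> qnil (z * y).
Proof.
move=> hz czy; apply: qnil_of_small => mu.
have y0 := bnorm_ge0 nB y; pose K : R := nrm y + 1.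
have K0 : 0 < K by rewrite /K; lra.
have [j hj] := qnil_pow_small (qnilZ (mu * K%:C) hz).
exists (2 ^ j)%N.
have -> : mu *: (z * y) = ((mu * K%:C) *: z) * ((K^-1)%:C *: y).
  rewrite -scalerAl -scalerAr !scalerA -mulrA -rmorphM mulfV ?gt_eqF //.
  by rewrite rmorph1 mulr1.
rewrite exprMn_comm; last by rewrite /GRing.comm -!scalerAl -!scalerAr czy !scalerA mulrC.
apply: (le_trans (bnormM nB _ _)); rewrite -[leRHS]mulr1.
apply: ler_pM; rewrite ?(bnorm_ge0 nB) //.
(* A positive exponent is required, since [nrm 1] may exceed 1. *)
rewrite -(prednK (expn_gt0 2 j)); apply: (bnormX_le1 nB).
rewrite (bnormZ nB) cnorm_real ger0_norm ?invr_ge0; last exact: ltW.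
by rewrite ler_pdivrMl // mulr1 /K; lra.
Qed.

Lemma qnil_root z n : qnil (z ^+ n) -> qnil z.
Proof.
move=> h mu; apply: (@invertible_sub1X _ _ n); rewrite exprZn; exact: h.
Qed.

(* An inverse of a quasinilpotent element would be quasinilpotent too, and the
   powers of both would tend to zero. *)
Lemma qnil_not_invertible z : qnil z -> ~ invertible z.
Proof.
move=> hz [y zy yz].
have hy : qnil y.
  move=> mu; have [->|mu0] := eqVneq mu 0; first by rewrite scale0r subr0; exact: invertible1.
  have -> : 1 - mu *: y = (- mu *: y) * (1 - mu^-1 *: z).
    rewrite mulrBr mulr1 -scalerAl -scalerAr yz scalerA mulNr mulfV // !scaleNr scale1r opprK.
    by rewrite addrC.
  apply: invertibleM; last exact: hz.
  exists (- mu^-1 *: z); rewrite -scalerAl -scalerAr scalerA mulrNN ?mulVf ?mulfV // scale1r //.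
have [j hj] := qnil_pow_small hz; have [k hk] := qnil_pow_small hy.
have h1 := pow2_decay k hj; have h2 := pow2_decay j hk; rewrite addnC in h2.
have := bnormM nB (z ^+ (2 ^ (j + k))) (y ^+ (2 ^ (j + k))).
rewrite -exprMn_comm ?zy ?expr1n; last by rewrite /GRing.comm zy yz.
have := bnorm1_ge1 nB.
have le1 i : (2^-1 : R) ^+ i.+1 <= 2^-1.
  by rewrite exprS ler_piMr ?invr_ge0 // exprn_ile1 ?invr_ge0 // invf_le1 // ler1n.
have := ler_pM (bnorm_ge0 nB _) (bnorm_ge0 nB _) (le_trans h1 (le1 _)) (le_trans h2 (le1 _)).
lra.
Qed.
End SpectralRadius.

(** * Lifting idempotents modulo a quasinilpotent element *)

Section IdempotentLifting.
Variables (R : realType) (B : algType R[i]) (nrm : B -> R).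
Hypothesis nB : banach_norm nrm.
Implicit Types (x y z : B) (mu nu lam : R[i]).
Local Notation C := R[i].

Lemma comm_horner_alg x y (P : {poly C}) : GRing.comm x y -> GRing.comm x (horner_alg y P).
Proof.
move=> c; elim/poly_ind: P => [|P a IH]; first by rewrite rmorph0; exact: commr0.
rewrite rmorphD rmorphM /= horner_algX horner_algC; apply: commrD; first exact: commrM.
by rewrite /GRing.comm -scalerAl -scalerAr mul1r mulr1.
Qed.

(* With q = X - X^2, the three components m, l, s are such that p = X + q m is the
   j-th Newton iterate, p - p^2 = q l and s = 1 - 2 p. Following m and l rather
   than p keeps p - X and p - p^2 visibly divisible by q in the limit. *)
Fixpoint newton (j : nat) : {poly C} * {poly C} * {poly C} :=
  if j is i.+1 then
    let: (m, l, s) := newton i in let h := ('X - 'X^2) * l in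
    (m - l * s, l * (h * (3 + 4 * h)), s * (1 + 2 * h))
  else (0, 1, 1 - 2 * 'X).

(** With h = p - p^2, the new iterate is p - h (1 - 2 p) = 3 p^2 - 2 p^3, and its defect is h^2 (3 +
    4 h), quadratic in the old one. *)
Lemma newton_spec j : let: (m, l, s) := newton j in
  let p := 'X + ('X - 'X^2) * m in
  s = 1 - 2 * p /\ p - p ^+ 2 = ('X - 'X^2) * l.
Proof.
elim: j => [|j] /=; first by rewrite mulr0 addr0 mulr1.
case: (newton j) => -[m l] s /= [-> hp].
set q := 'X - 'X^2 in hp *; set p := 'X + q * m in hp *.
have e : 'X + q * (m - l * (1 - 2 * p)) = p - (q * l) * (1 - 2 * p).
  by rewrite mulrBr addrA mulrA.
rewrite e [q * (l * _)]mulrA -hp; split; ring.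
Qed.

Lemma idempotent_lift e : qnil (e - e ^+ 2) -> exists m,
  let p := e + (e - e ^+ 2) * m in
  p * p = p /\ forall x, GRing.comm x e -> GRing.comm x m.
Proof.
set q := e - e ^+ 2 => hq.
have [J hJ] := qnil_pow_small nB (qnilZ 8 hq).
have M0 := expn_gt0 2 J; move: (2 ^ J)%N M0 hJ => M M0 hM.
(* [N] is a norm equivalent to [nrm] for which multiplication by [q] has operator
   norm at most 1/8 whatever [nrm q] is; [Dom y t] bounds the operator norm of [y]. *)
pose N v := \sum_(i < M) nrm ((8 *: q) ^+ i * v).
have N0 v : 0 <= N v by apply: sumr_ge0 => i _; exact: bnorm_ge0 nB _.
have leN v : nrm v <= N v.
  rewrite /N; case: (M) M0 => // M' _; rewrite big_ord_recl expr0 mul1r lerDl.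
  by apply: sumr_ge0 => i _; exact: bnorm_ge0 nB _.
pose Dom y t := forall v, N (y * v) <= t * N v.
have DomW y s t : Dom y s -> s <= t -> Dom y t.
  by move=> h st v; apply: (le_trans (h v)); exact: ler_wpM2r.
have DomM y z s t : 0 <= s -> Dom y s -> Dom z t -> Dom (y * z) (s * t).
  move=> s0 hy hz v; rewrite -!mulrA; apply: (le_trans (hy _)).
  exact: ler_wpM2l.
have DomD y z s t : Dom y s -> Dom z t -> Dom (y + z) (s + t).
  move=> hy hz v; rewrite !mulrDl; apply: le_trans (lerD (hy v) (hz v)).
  rewrite /N -big_split; apply: ler_sum => i _; rewrite mulrDr; exact: bnormD nB _ _.
have Domn n : Dom n%:R n%:R.
  elim: n => [|n IH v]; last first.
    rewrite -addn1 !natrD; apply: DomD => // w; by rewrite !mul1r.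
  by move=> v; rewrite !mul0r /N big1 // => i _; rewrite mulr0 (bnorm0 nB).
have DomC y : GRing.comm y q -> Dom y (nrm y).
  move=> c v; rewrite /N mulr_sumr; apply: ler_sum => i _; rewrite mulrA.
  have -> : (8 *: q) ^+ i * y = y * (8 *: q) ^+ i.
    by apply/commr_sym/commrX; rewrite /GRing.comm -scalerAr -scalerAl c.
  by rewrite -mulrA; exact: bnormM nB _ _.
have Domq : Dom q 8^-1.
  (* Multiplication by 8 q shifts the sum by one index: the first term [nrm v] is lost and the new
     last term is at most [nrm v] by the choice of [M]. *)
  have h v : N ((8 *: q) * v) <= N v.
    rewrite /N; under eq_bigr do rewrite mulrA -exprSr.
    rewrite -(lerD2l (nrm ((8 *: q) ^+ 0 * v))).
    rewrite -(big_ord_recl M (fun i => nrm ((8 *: q) ^+ i * v))) big_ord_recr /= addrC.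
    rewrite lerD2r expr0 mul1r; apply: (le_trans (bnormM nB _ _)).
    by rewrite ler_piMl ?(bnorm_ge0 nB) //; apply: (le_trans hM); rewrite invf_le1 // ler1n.
  move=> v; rewrite ler_pdivlMl //.
  apply: le_trans (h v); rewrite /N mulr_sumr; apply: ler_sum => i _.
  rewrite -scalerAl -scalerAr (bnormZ nB).
  have -> // : cnorm (8 : C) = 8.
  by have := @cnorm_real R 8; rewrite rmorph_nat => ->; rewrite ger0_norm.
have h8 : 0 <= (8^-1 : R) by rewrite invr_ge0.
pose f : {rmorphism {poly C} -> B} := horner_alg e.
have fX : f 'X = e by exact: horner_algX.
have fq : f ('X - 'X^2) = q by rewrite rmorphB rmorphXn fX.
pose S := nrm (1 - 2 * e).
have S0 : 0 <= S := bnorm_ge0 nB _.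
pose mm j := f (newton j).1.1; pose ll j := f (newton j).1.2; pose ss j := f (newton j).2.
have hp j : 0 < (2^-1 : R) ^+ j by rewrite exprn_gt0 // invr_gt0.
have hp1 j : (2^-1 : R) ^+ j <= 1 by rewrite exprn_ile1 ?invr_ge0 // invf_le1 // ler1n.
(* With u = 2^-j, h has bound u/8. Since u <= 1, (u/8)(3 + u/2) <= 1/2 halves the bound on [ll], and
   (2 - u)(1 + u/4) <= 2 - u/2 keeps [ss] bounded. *)
have est j : Dom (ll j) (2^-1 ^+ j) /\ Dom (ss j) (S * (2 - 2^-1 ^+ j)).
  elim: j => [|j [IHl IHs]].
    rewrite /ll /ss /= rmorph1 rmorphB rmorphM /= rmorph1 rmorph_nat fX.
    split; first exact: (Domn 1%N).
    apply: (DomW _ _ _ (DomC _ _)); last by rewrite expr0 -/S; lra.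
    apply/commr_sym; apply: commrB; first exact: commr1.
    apply: commrM; first exact: commr_nat.
    by apply/commr_sym; apply: commrB => //; exact: commrX.
  have : newton j.+1 = let: (m, l, s) := newton j in let h := ('X - 'X^2) * l in
    (m - l * s, l * (h * (3 + 4 * h)), s * (1 + 2 * h)) by [].
  move: IHl IHs; rewrite /ll /ss; case: (newton j) => -[m l] s /= IHl IHs -> /=.
  set u := 2^-1 ^+ j in IHl IHs *.
  have u0 : 0 < u := hp j. have u1 : u <= 1 := hp1 j.
  have hh : Dom (f (('X - 'X^2) * l)) (8^-1 * u).
    by rewrite rmorphM /= fq; apply: DomM => //; rewrite invr_ge0.
  move: hh; set h := _ * l => hh.
  have -> : f (l * (h * (3 + 4 * h))) = f l * (f h * (3 + 4 * f h)).
    by rewrite rmorphM [f (h * _)]rmorphM [f (3 + _)]rmorphD [f (4 * h)]rmorphM !rmorph_nat.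
  have -> : f (s * (1 + 2 * h)) = f s * (1 + 2 * f h).
    by rewrite rmorphM [f (1 + _)]rmorphD [f (2 * h)]rmorphM rmorph1 rmorph_nat.
  split.
    have d3 := DomD _ _ _ _ (Domn 3%N) (DomM _ _ _ _ (ler0n R 4) (Domn 4%N) hh).
    have hu : 0 <= 8^-1 * u by rewrite mulr_ge0 ?invr_ge0 // ltW.
    apply: (DomW _ _ _ (DomM _ _ _ _ (ltW u0) IHl (DomM _ _ _ _ hu hh d3))).
    by rewrite exprS -/u; nra.
  have d2 := DomD _ _ _ _ (Domn 1%N) (DomM _ _ _ _ (ler0n R 2) (Domn 2%N) hh).
  have hS : 0 <= S * (2 - u) by rewrite mulr_ge0 //; lra.
  apply: (DomW _ _ _ (DomM _ _ _ _ hS IHs d2)).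
  by rewrite -mulrA ler_wpM2l // exprS -/u; nra.
pose K := 2 * S * N 1.
have [|m hm] := @geometric_limit _ _ _ nB mm K.
  move=> j; have -> : mm j.+1 - mm j = - (ll j * ss j).
    rewrite /mm /ll /ss /=; case: (newton j) => -[a b] c /=.
    by rewrite rmorphB rmorphM /= addrAC subrr add0r.
  rewrite (bnormN nB) -[_ * ss j]mulr1; apply: (le_trans (leN _)).
  have [h1 h2] := est j; apply: (le_trans (DomM _ _ _ _ (ltW (hp j)) h1 h2 1)).
  have -> : K * 2^-1 ^+ j = 2^-1 ^+ j * (S * 2) * N 1 by rewrite /K; ring.
  by rewrite ler_wpM2r // ler_wpM2l ?(ltW (hp j)) // ler_wpM2l // gerBl ltW.
have K0 : 0 <= K by rewrite /K !mulr_ge0.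
exists m; split; last first.
  move=> x cx; apply/eqP; rewrite -subr_eq0; apply/eqP.
  apply: (@small_eq0 _ _ _ nB _ (2 * nrm x * (2 * K))) => j.
  have c : GRing.comm x (mm j) by exact: comm_horner_alg.
  have -> : x * m - m * x = x * (m - mm j) - (m - mm j) * x.
    by rewrite mulrBr mulrBl c opprB addrA subrK.
  have h := hm j; rewrite (bnorm_distC nB) in h.
  have -> : 2 * nrm x * (2 * K) * 2^-1 ^+ j =
      nrm x * (2 * K * 2^-1 ^+ j) + 2 * K * 2^-1 ^+ j * nrm x by ring.
  apply: (le_trans (bnormB nB _ _)); apply: lerD; apply: (le_trans (bnormM nB _ _)).
    by rewrite ler_wpM2l ?(bnorm_ge0 nB).
  by rewrite ler_wpM2r ?(bnorm_ge0 nB).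
set p := e + q * m; apply/eqP; rewrite eq_sym -subr_eq0; apply/eqP.
pose pp j := e + q * mm j.
have hpp j : nrm (p - pp j) <= nrm q * (2 * K) * 2^-1 ^+ j.
  rewrite /p /pp opprD addrACA subrr add0r -mulrBr; apply: (le_trans (bnormM nB _ _)).
  by rewrite -mulrA ler_wpM2l ?(bnorm_ge0 nB) // (bnorm_distC nB); exact: hm.
set T := nrm q * (2 * K) in hpp.
have T0 : 0 <= T by rewrite !mulr_ge0 ?(bnorm_ge0 nB).
apply: (@small_eq0 _ _ _ nB _ (T + T * nrm p + (nrm p + T) * T + N 1)) => j.
have tri (x y z : B) : (x - y) + (y - z) = x - z by rewrite addrA subrK.
(* The defect of the limit [p] is that of [pp j], which tends to 0, plus terms containing the factor
   [p - pp j]. *)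
have alg (x y : B) : x - x * x = (x - y) - (x - y) * x - y * (x - y) + (y - y * y).
  by rewrite mulrBl mulrBr -[X in _ = X + _]addrA -opprD tri addrAC tri opprB tri.
rewrite (alg p (pp j)).
have hpj : pp j - pp j * pp j = q * ll j.
  have := newton_spec j; rewrite /pp /mm /ll; case: (newton j) => -[a b] c /= [_ /(congr1 f)].
  by rewrite !(rmorphB, rmorphD, rmorphXn, rmorphM) /= fX -/q expr2.
have -> : (T + T * nrm p + (nrm p + T) * T + N 1) * 2^-1 ^+ j =
  T * 2^-1 ^+ j + T * 2^-1 ^+ j * nrm p + (nrm p + T) * (T * 2^-1 ^+ j) + 2^-1 ^+ j * N 1 by ring.
apply: (le_trans (bnormD nB _ _)); apply: lerD; last first.
  rewrite hpj; apply: (le_trans (leN _)); rewrite -[q * _]mulr1.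
  have [h1 _] := est j; apply: (le_trans (DomM _ _ _ _ h8 Domq h1 1)).
  by rewrite ler_wpM2r //; have := hp j; lra.
apply: (le_trans (bnormB nB _ _)); apply: lerD.
  apply: (le_trans (bnormB nB _ _)); apply: lerD; first exact: hpp.
  by apply: (le_trans (bnormM nB _ _)); rewrite ler_wpM2r ?(bnorm_ge0 nB) ?hpp.
apply: (le_trans (bnormM nB _ _)); apply: ler_pM; rewrite ?(bnorm_ge0 nB) ?hpp //.
have -> : pp j = p - (p - pp j) by rewrite subKr.
apply: (le_trans (bnormB nB _ _)); rewrite lerD2l; apply: (le_trans (hpp j)).
by rewrite ler_piMr.
Qed.
End IdempotentLifting.

(** * The spectral criterion *)

Section RootSpectrum.
Variables (R : realType) (B : algType R[i]) (nrm : B -> R).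
Hypothesis nB : banach_norm nrm.
Implicit Types (x y z : B) (mu nu lam : R[i]).
Local Notation C := R[i].

Lemma commr_alg x (c : C) : GRing.comm x c%:A.
Proof. by rewrite /GRing.comm -scalerAl -scalerAr mul1r mulr1. Qed.

Lemma invertible_alg (c : C) : c != 0 -> invertible (c%:A : B).
Proof.
by move=> c0; exists (c^-1)%:A; rewrite -scalerAl mul1r scalerA ?mulfV ?mulVf ?scale1r.
Qed.

Lemma qnil_shift_invertible z (c : C) : c != 0 -> qnil z -> invertible (c%:A - z).
Proof.
move=> c0 hz; have -> : c%:A - z = c%:A * (1 - c^-1 *: z).
  by rewrite mulrBr mulr1 -scalerAl mul1r scalerA mulfV // scale1r.
by apply: invertibleM; [exact: invertible_alg | exact: hz].
Qed.

(** The complex polynomial splits into linear factors. [Q] is abstract in order to serve left, right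
    and two-sided invertibility alike. *)
Lemma horner_alg_factors (Q : B -> Prop) (a : B) (P : {poly C}) :
  (forall x y, Q x -> Q y -> Q (x * y)) -> (forall c : C, c != 0 -> Q c%:A) ->
  P != 0 -> (forall r, root P r -> Q (r%:A - a)) -> Q (horner_alg a P).
Proof.
move=> QM Qc P0 hP; have [rs Prs] := closed_field_poly_normal P.
have rsP r : r \in rs -> root P r.
  by rewrite Prs rootZ ?lead_coef_eq0 // root_prod_XsubC.
rewrite Prs -mul_polyC rmorphM /= horner_algC; apply: (QM); first by apply: Qc; rewrite lead_coef_eq0.
elim: rs rsP {Prs} => [|r rs IH] hr.
  by rewrite big_nil rmorph1 -[1]scale1r; apply: Qc; exact: oner_neq0.
rewrite big_cons rmorphM /=; apply: (QM).
  rewrite rmorphB /= horner_algX horner_algC -opprB -mulN1r -scaleN1r; apply: (QM).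
    by apply: Qc; rewrite oppr_eq0 oner_neq0.
  by apply/hP/hr; rewrite mem_head.
by apply: IH => s hs; apply: hr; rewrite in_cons hs orbT.
Qed.

Lemma horner_alg_sub_factor (a : B) (P : {poly C}) (lam : C) :
  exists G : {poly C}, (P.[lam])%:A - horner_alg a P = (lam%:A - a) * horner_alg a G.
Proof.
have /factor_theorem[G hG] : root (P - (P.[lam])%:P) lam.
  by rewrite rootE hornerD hornerN hornerC subrr.
exists G; have := congr1 (horner_alg a) hG.
rewrite rmorphM !rmorphB /= !horner_algC horner_algX => e.
rewrite -opprB e -mulrN opprB; apply: commr_sym; apply: comm_horner_alg.
by apply: commr_sym; apply: commrB => //; exact: commr_alg.
Qed.

Definition root_spectrum n (a : B) :=
  forall lam : C, lam ^+ n.+1 != lam -> invertible (lam%:A - a).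

(** A spectral mapping argument: [P] does not vanish at a root r of 1 - mu P, so r^(n+1) differs
    from r and r - a satisfies [Q]. The polynomial 1 - mu P is nonzero because its value at 0 is
    1. *)
Lemma root_spectrum_qnil (Q : B -> Prop) n (a : B) (P : {poly C}) :
  (forall x y, Q x -> Q y -> Q (x * y)) -> (forall c : C, c != 0 -> Q c%:A) ->
  (forall x, Q x -> rinvertible x \/ linvertible x) ->
  (forall lam : C, lam ^+ n.+1 != lam -> Q (lam%:A - a)) ->
  (forall lam : C, lam ^+ n.+1 = lam -> P.[lam] = 0) -> qnil (horner_alg a P).
Proof.
move=> QM Qc Qrl hQ hP; apply: (qnil_one_sided nB) => mu; apply: Qrl.
have -> : 1 - mu *: horner_alg a P = horner_alg a (1 - mu *: P).
  by rewrite rmorphB rmorph1 -mul_polyC rmorphM /= horner_algC -scalerAl mul1r.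
apply: horner_alg_factors => //.
  apply/eqP => /(congr1 (fun p : {poly C} => p.[0])).
  rewrite hornerD hornerN hornerZ hP ?expr0n // mulr0 subr0 hornerC horner0.
  by move/eqP; rewrite oner_eq0.
move=> r; rewrite rootE hornerD hornerN hornerZ hornerC => hr; apply: hQ.
by apply: contraTneq hr => /hP ->; rewrite mulr0 subr0 oner_eq0.
Qed.

Lemma qnil_root_spectrum n (a : B) : qnil (a - a ^+ n.+1) -> root_spectrum n a.
Proof.
move=> h lam hl; have [G] := horner_alg_sub_factor a ('X - 'X^(n.+1)) lam.
rewrite rmorphB rmorphXn /= horner_algX hornerD hornerN hornerX hornerXn => e.
apply: (@invertible_factor _ _ (horner_alg a G)).
  by apply: comm_horner_alg; apply/commr_sym/commrB => //; exact: commr_alg.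
by rewrite -e; apply: qnil_shift_invertible; rewrite // subr_eq0 eq_sym.
Qed.

(** One-sided inverses already make a - a^(n+1) quasinilpotent, and [qnil_root_spectrum] turns this
    back into two-sided inverses. *)
Lemma root_spectrum_one_sided (Q : B -> Prop) n (a : B) :
  (forall x y, Q x -> Q y -> Q (x * y)) -> (forall c : C, c != 0 -> Q c%:A) ->
  (forall x, Q x -> rinvertible x \/ linvertible x) ->
  (forall lam : C, lam ^+ n.+1 != lam -> Q (lam%:A - a)) -> root_spectrum n a.
Proof.
move=> QM Qc Qrl hQ; apply: qnil_root_spectrum.
have := @root_spectrum_qnil Q n a ('X - 'X^(n.+1)) QM Qc Qrl hQ.
rewrite rmorphB rmorphXn /= horner_algX; apply => lam e.
by rewrite hornerD hornerN hornerX hornerXn e subrr.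
Qed.

Lemma root_spectrum_r n (a : B) :
  (forall lam : C, lam ^+ n.+1 != lam -> rinvertible (lam%:A - a)) -> root_spectrum n a.
Proof.
apply: root_spectrum_one_sided; [exact: rinvertibleM | | by left].
by move=> c c0; exact/invertible_r/invertible_alg.
Qed.

Lemma root_spectrum_l n (a : B) :
  (forall lam : C, lam ^+ n.+1 != lam -> linvertible (lam%:A - a)) -> root_spectrum n a.
Proof.
apply: root_spectrum_one_sided; [exact: linvertibleM | | by right].
by move=> c c0; exact/invertible_l/invertible_alg.
Qed.

(** Allows two elements with different exponents to be given a common one. *)
Lemma root_spectrum_muln n m (a : B) : root_spectrum n a -> root_spectrum (n * m) a.
Proof.
move=> h lam hl; apply: h; apply: contra hl => /eqP e; apply/eqP.
have [->|l0] := eqVneq lam 0; first by rewrite expr0n.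
have : lam ^+ n = 1 by apply: (mulfI l0); rewrite -exprS mulr1.
by rewrite exprS exprM => ->; rewrite expr1n mulr1.
Qed.

Definition hirano (a : B) := exists x, [/\ x * a * x = x, a * x = x * a &
  exists n : nat, (0 < n)%N /\ qnil (a - a ^+ (n + 2) * x)].

(** The idempotent p = a x commutes with [a]. On the part 1 - p, [a] agrees with the quasinilpotent
    [w]; on the part p, a - a^(n+1) agrees with [w], and lam - a divides P(lam) - P(a) for P = X -
    X^(n+1). The inverse of lam - a is glued from these two parts. *)
Lemma hirano_root_spectrum (a : B) : hirano a -> exists2 n, (0 < n)%N & root_spectrum n a.
Proof.
case=> x [xax ax [n [n0]]]; set w := a - _ => hw; exists n => // lam hl.
have [p hp] : exists p, p = a * x by exists (a * x).
have cap : a * p = p * a by rewrite hp {1}ax mulrA.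
have pp : p * p = p by rewrite hp -mulrA (mulrA x) xax.
have wE : w = a - a ^+ n.+1 * p by rewrite /w addn2 exprSr -mulrA hp.
have cpX : a ^+ n.+1 * p = p * a ^+ n.+1 by apply/commr_sym/commrX.
have cwp : w * p = p * w by rewrite wE mulrBl mulrBr cap; congr (_ - _); rewrite mulrA -cpX.
have lam0 : lam != 0 by apply: contraNneq hl => ->; rewrite expr0n.
have [W1 w1 w1'] := qnil_shift_invertible lam0 hw.
pose P : {poly C} := 'X - 'X^(n.+1).
have Pl : P.[lam] = lam - lam ^+ n.+1 by rewrite hornerD hornerN hornerX hornerXn.
have Pl0 : P.[lam] != 0 by rewrite Pl subr_eq0 eq_sym.
have [W2 w2 w2'] := qnil_shift_invertible Pl0 hw.
have [G hG] := horner_alg_sub_factor a P lam.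
set g := horner_alg a G in hG.
have fP : horner_alg a P = a - a ^+ n.+1 by rewrite rmorphB rmorphXn /= horner_algX.
have cl : GRing.comm (lam%:A - a) p.
  apply/commr_sym/commrB; first exact: commr_alg.
  by rewrite /GRing.comm cap.
have cg : (lam%:A - a) * g = g * (lam%:A - a).
  by apply: comm_horner_alg; apply/commr_sym/commrB => //; exact: commr_alg.
have c1 : GRing.comm (lam%:A - w) p.
  by apply/commr_sym/commrB; [exact: commr_alg | rewrite /GRing.comm cwp].
have c2 : GRing.comm (P.[lam]%:A - w) p.
  by apply/commr_sym/commrB; [exact: commr_alg | rewrite /GRing.comm cwp].
have e1 : (lam%:A - a) * (1 - p) = (lam%:A - w) * (1 - p).
  have z0 : a ^+ n.+1 * p * (1 - p) = 0 by rewrite -mulrA mulrBr mulr1 pp subrr mulr0.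
  by rewrite wE 2!mulrBl [(a - _) * _]mulrBl z0 subr0.
have cgp : p * g = g * p by exact: comm_horner_alg.
have e2 : (lam%:A - a) * g * p = (P.[lam]%:A - w) * p.
  by rewrite -hG fP wE 4!mulrBl -mulrA pp.
have d1 : GRing.comm (lam%:A - a) (1 - p) by apply: commrB => //; exact: commr1.
have d2 : GRing.comm (lam%:A - w) (1 - p) by apply: commrB => //; exact: commr1.
apply: rlinvertible.
  exists ((1 - p) * W1 + g * p * W2); rewrite mulrDr.
  have -> : (lam%:A - a) * ((1 - p) * W1) = 1 - p.
    by rewrite mulrA e1 d2 -mulrA w1 mulr1.
  have -> : (lam%:A - a) * (g * p * W2) = p.
    by rewrite mulrA (mulrA (lam%:A - a)) e2 c2 -mulrA w2 mulr1.
  by rewrite subrK.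
exists (W1 * (1 - p) + W2 * (p * g)); rewrite mulrDl.
have -> : W1 * (1 - p) * (lam%:A - a) = 1 - p.
  by rewrite -mulrA -d1 e1 mulrA w1' mul1r.
have -> : W2 * (p * g) * (lam%:A - a) = p.
  rewrite -mulrA -(mulrA p) -cg (mulrA p) -cl -mulrA cgp (mulrA (lam%:A - a)) e2.
  by rewrite mulrA w2' mul1r.
by rewrite subrK.
Qed.

Lemma root_spectrum_hirano n (a : B) : (0 < n)%N -> root_spectrum n a -> hirano a.
Proof.
move=> n0 ha; have [e eE] : exists e, e = a ^+ n by exists (a ^+ n).
have [q qE] : exists q, q = e - e ^+ 2 by exists (e - e ^+ 2).
have hq : qnil q.
  rewrite qE eE.
  have := @root_spectrum_qnil (@invertible B) n a ('X^n - 'X^n ^+ 2).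
  rewrite rmorphB !rmorphXn /= horner_algX; apply => //.
  - exact: invertibleM.
  - exact: invertible_alg.
  - by move=> x /invertible_r; left.
  - move=> lam hl; rewrite hornerD hornerN !horner_exp hornerX.
    have [->|l0] := eqVneq lam 0; first by rewrite expr0n gtn_eqF // expr0n subrr.
    have -> : lam ^+ n = 1 by apply: (mulfI l0); rewrite -exprS mulr1.
    by rewrite expr1n subrr.
have [m] : exists m, let p := e + q * m in p * p = p /\ forall x, GRing.comm x e -> GRing.comm x m.
  by rewrite qE in hq *; exact: (idempotent_lift nB hq).
have [p pE] : exists p, p = e + q * m by exists (e + q * m).
rewrite /= -pE => -[pp cm].
have cae : GRing.comm a e by rewrite eE; apply: commrX.
have cam : GRing.comm a m by exact: cm.
have cee : GRing.comm e e by [].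
have cem : GRing.comm e m by exact: cm.
have cx y : GRing.comm y e -> [/\ GRing.comm y m, GRing.comm y q & GRing.comm y p].
  move=> h; have hm := cm _ h; have hy : GRing.comm y q by rewrite qE; apply: commrB => //; exact: commrX.
  by split => //; rewrite pE; apply: commrD => //; exact: commrM.
have [_ ceq cep] := cx _ cee; have [_ caq cap] := cx _ cae.
have cqm : GRing.comm q m by apply: cm; exact: commr_sym.
have c1 y : GRing.comm y 1 := commr1 y.
(* As [p] and [e] agree modulo [q], [h] is a multiple of [q], hence quasinilpotent. Its complement 1
   - h has inverse [v], and p (1 - h) = e p then gives a x = e p v = p. *)
pose h := p * (1 - e).
have hE : h = q * (1 + m * (1 - e)).
  by rewrite /h pE mulrDl [e * _]mulrBr mulr1 -expr2 -qE [RHS]mulrDr mulr1 mulrA.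
have hh : qnil h.
  rewrite hE; apply: (qnilM nB) => //; apply: commrD => //; apply: commrM => //.
  by apply: commrB => //; exact: commr_sym.
have [v hv vh] := hh 1; rewrite scale1r in hv vh.
have cv y : GRing.comm y e -> GRing.comm y v.
  move=> hy; have [_ _ hyp] := cx _ hy; apply: (comm_inv hv vh).
  by apply: commrB => //; apply: commrM => //; apply: commrB.
have cav := cv _ cae.
have ph : p * (1 - h) = e * p.
  by rewrite mulrBr mulr1 /h mulrA pp mulrBr mulr1 subKr cep.
have cpv : GRing.comm p v by apply: cv; exact: commr_sym.
pose x := a ^+ n.-1 * p * v.
have axE : a * x = p.
  by rewrite /x !mulrA -exprS prednK // -eE -ph -mulrA hv mulr1.
have cax : a * x = x * a.
  by apply: commrM => //; apply: commrM => //; apply: commrX.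
exists x; split => //.
  by rewrite -mulrA axE /x -mulrA -cpv mulrA -[_ * p * p]mulrA pp.
exists n; split => //.
have -> : a - a ^+ (n + 2) * x = a * (1 - e * p).
  by rewrite addn2 exprSr -mulrA axE exprS -eE mulrBr mulr1 mulrA.
(* The n-th power of [a (1 - e p)] is divisible by [e (1 - e p)], hence by [q]. *)
apply: (@qnil_root _ _ _ n).
have c1ep : GRing.comm a (1 - e * p) by apply: commrB => //; apply: commrM.
rewrite exprMn_comm // -eE -(prednK n0) [(1 - _) ^+ _.+1]exprS mulrA.
have q1 : q * (1 + e) = e - e * e * e.
  by rewrite qE expr2 mulrDr mulr1 mulrBl addrA subrK.
have eq1 : e * (1 - e * p) = q * (1 + e - e * e * m).
  rewrite mulrBr mulr1 [RHS]mulrBr q1 pE mulrA mulrDr opprD addrA; congr (_ - _).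
  by rewrite !mulrA -(mulrA e e) ceq mulrA ceq.
rewrite eq1 -mulrA; apply: (qnilM nB) => //.
have cqe : GRing.comm q e by exact: commr_sym.
have [_ _ cqp] := cx _ cqe.
apply: commrM.
  by apply: commrB; [apply: commrD | apply: commrM => //; apply: commrM].
by apply: commrX; apply: commrB => //; apply: commrM.
Qed.
End RootSpectrum.

(** * Sums *)

Section HiranoSum.
Variables (R : realType) (B : algType R[i]) (nrm : B -> R).
Hypothesis nB : banach_norm nrm.
Implicit Types (x y z : B) (mu nu lam : R[i]).
Local Notation C := R[i].

Section Sum.
Variables (a b : B) (k : nat).
Hypothesis wordsP : forall s : seq B, size s = k ->
  (forall x, x \in s -> x = a \/ x = b) -> (\prod_(x <- s) x) * a * b = 0.

(** Expands the power one factor at a time, each factor lengthening the word by [a] or [b]; once the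
    word has at least [k] letters, its last [k] letters annihilate a b. *)
Lemma word_pow_annihilates j (s : seq B) : (k <= size s + j)%N ->
  (forall x, x \in s -> x = a \/ x = b) ->
  (\prod_(x <- s) x) * (a + b) ^+ j * a * b = 0.
Proof.
elim: j s => [|j IH] s hs ab.
  rewrite addn0 in hs; rewrite mulr1 -(cat_take_drop (size s - k) s) big_cat /=.
  rewrite -!mulrA [_ * (a * b)]mulrA wordsP ?mulr0 //.
    by rewrite size_drop subKn.
  by move=> x /mem_drop; exact: ab.
have grow c : c = a \/ c = b -> (\prod_(x <- s) x) * c * (a + b) ^+ j * a * b = 0.
  move=> hc; have := IH (s ++ [:: c]); rewrite big_cat big_seq1 /=; apply.
    by rewrite size_cat /= addn1 addSnnS.
  by move=> x; rewrite mem_cat inE => /orP[/ab//|/eqP ->].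
by rewrite exprS mulrA mulrDr !mulrDl !grow ?addr0; [| right | left].
Qed.

Lemma prod_nseq (c : B) i : \prod_(x <- nseq i c) x = c ^+ i.
Proof. by rewrite big_nseq iter_mulr_1. Qed.

Lemma pow_annihilates : a ^+ k * a * b = 0.
Proof.
rewrite -prod_nseq; apply: wordsP; first exact: size_nseq.
by move=> x /nseqP[-> _]; left.
Qed.

Lemma pow_sum_annihilates i : b ^+ k * (a + b) ^+ i * a * b = 0.
Proof.
rewrite -(prod_nseq b); apply: word_pow_annihilates; first by rewrite size_nseq leq_addr.
by move=> x /nseqP[-> _]; right.
Qed.

Lemma sum_pow_annihilates : (a + b) ^+ k * a * b = 0.
Proof.
by have := @word_pow_annihilates k [::]; rewrite big_nil mul1r; exact.
Qed.

(** With c = a + b, c^k a b = 0 makes c^k a right multiple of lam - c. So is lam^k - c^k, hence also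
    the nonzero scalar lam^k, which yields a right inverse. The next two lemmas follow the same
    pattern. *)
Lemma root_spectrum_sum n : root_spectrum n a -> root_spectrum n b -> root_spectrum n (a + b).
Proof.
move=> ha hb; apply: (root_spectrum_r nB) => lam hl.
have lam0 : lam != 0 by apply: contraNneq hl => ->; rewrite expr0n.
have [u hu _] := ha _ hl; have [v hv _] := hb _ hl.
have [c cE] : exists c, c = a + b by exists (a + b).
have hc := sum_pow_annihilates; rewrite -cE in hc *.
have e : c ^+ k * (lam%:A - a) * (lam%:A - b) = (lam%:A - c) * (lam%:A * c ^+ k).
  have cl x : x * lam%:A = lam%:A * x by exact: commr_alg.
  have s1 : c ^+ k * (lam%:A - a) * b = lam%:A * (c ^+ k * b).
    by rewrite mulrBr mulrBl hc subr0 cl mulrA.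
  have s2 : c ^+ k * (lam%:A - c) = (lam%:A - c) * c ^+ k.
    by apply/commr_sym/commrX/commr_sym/commrB => //; exact: commr_alg.
  rewrite [LHS]mulrBr cl s1 -mulrBr -mulrBr -addrA -opprD -cE s2 !mulrA.
  by rewrite -cl.
have ck : c ^+ k = (lam%:A - c) * (lam%:A * c ^+ k * (v * u)).
  by rewrite mulrA -e -!mulrA (mulrA (lam%:A - b)) hv mul1r hu mulr1.
have [G hG] := horner_alg_sub_factor c 'X^k lam.
rewrite rmorphXn /= horner_algX hornerXn in hG.
set g := horner_alg c G in hG.
exists ((lam ^- k)%:A * (g + lam%:A * c ^+ k * (v * u))).
have -> (x y : B) : x * ((lam ^- k)%:A * y) = (lam ^- k)%:A * (x * y).
  by rewrite mulrA (commr_alg x) mulrA.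
rewrite mulrDr -hG -ck subrK -scalerAl mul1r scalerA mulVf ?scale1r //.
by rewrite expf_neq0.
Qed.

(** Since a^(k+1) b = 0, a^(k+1) intertwines lam - (a + b) with lam - a. *)
Lemma root_spectrum_suml n : root_spectrum n (a + b) -> root_spectrum n a.
Proof.
move=> hc; apply: (root_spectrum_r nB) => lam hl.
have lam0 : lam != 0 by apply: contraNneq hl => ->; rewrite expr0n.
have [u hu _] := hc _ hl.
have ca : a ^+ k.+1 * (lam%:A - (a + b)) = (lam%:A - a) * a ^+ k.+1.
  rewrite opprD addrA mulrBr exprSr pow_annihilates subr0 -exprSr; apply/commr_sym.
  by apply: commrX; apply/commr_sym/commrB => //; exact: commr_alg.
have ck : a ^+ k.+1 = (lam%:A - a) * (a ^+ k.+1 * u).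
  by rewrite mulrA -ca -mulrA hu mulr1.
have [G hG] := horner_alg_sub_factor a 'X^(k.+1) lam.
rewrite rmorphXn /= horner_algX hornerXn in hG.
exists ((lam ^- k.+1)%:A * (horner_alg a G + a ^+ k.+1 * u)).
have -> (x y : B) : x * ((lam ^- k.+1)%:A * y) = (lam ^- k.+1)%:A * (x * y).
  by rewrite mulrA (commr_alg x) mulrA.
rewrite mulrDr -hG -ck subrK -scalerAl mul1r scalerA mulVf ?scale1r //.
by rewrite expf_neq0.
Qed.

(** Here c^k b intertwines on the other side, so a left inverse results: multiplying by b^k u, with
    u an inverse of lam - c, exhibits b^(2k+1) as a left multiple of lam - b. *)
Lemma root_spectrum_sumr n : root_spectrum n (a + b) -> root_spectrum n b.
Proof.
move=> hc; apply: (root_spectrum_l nB) => lam hl.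
have lam0 : lam != 0 by apply: contraNneq hl => ->; rewrite expr0n.
have [u _ hu] := hc _ hl.
have hk := sum_pow_annihilates.
have hj := pow_sum_annihilates.
have [c cE] : exists c, c = a + b by exists (a + b).
rewrite -cE in hc hk hj hu.
have cb : (lam%:A - c) * (c ^+ k * b) = c ^+ k * b * (lam%:A - b).
  rewrite mulrBl mulrBr -(commr_alg (c ^+ k * b)); congr (_ - _).
  by rewrite mulrA -exprS exprSr {2}cE mulrDr mulrDl hk add0r.
(* As b^k c^i a b = 0, the last factor c before b may be replaced by b, one at a time. *)
have bc i : b ^+ k * c ^+ i * b = b ^+ (k + i).+1.
  elim: i => [|i IH]; first by rewrite mulr1 addn0 exprSr.
  by rewrite exprSr {2}cE mulrDr mulrDr mulrDl !mulrA hj add0r IH -exprSr addnS.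
have ck : b ^+ (k + k).+1 = b ^+ k * u * (c ^+ k * b) * (lam%:A - b).
  by rewrite -!mulrA [_ * (b * (_ - _))]mulrA -cb (mulrA u) hu mul1r mulrA bc.
have [G hG] := horner_alg_sub_factor b 'X^((k + k).+1) lam.
rewrite rmorphXn /= horner_algX hornerXn in hG.
have cG : GRing.comm (lam%:A - b) (horner_alg b G).
  by apply: comm_horner_alg; apply/commr_sym/commrB => //; exact: commr_alg.
rewrite cG in hG.
exists ((lam ^- (k + k).+1)%:A * (horner_alg b G + b ^+ k * u * (c ^+ k * b))).
rewrite -[LHS]mulrA mulrDl -hG -ck subrK -scalerAl mul1r scalerA mulVf ?scale1r //.
by rewrite expf_neq0.
Qed.

Lemma hirano_sum : (hirano a /\ hirano b) <-> hirano (a + b).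
Proof.
split=> [[/hirano_root_spectrum[n n0 hn] /hirano_root_spectrum[m m0 hm]]|].
  apply: (@root_spectrum_hirano _ _ _ nB (n * m)); first by rewrite muln_gt0 n0.
  apply: root_spectrum_sum; first exact: root_spectrum_muln.
  by rewrite mulnC; exact: root_spectrum_muln.
case/hirano_root_spectrum=> n n0 hn.
by split; apply: (root_spectrum_hirano nB n0);
  [exact: root_spectrum_suml | exact: root_spectrum_sumr].
Qed.
End Sum.
End HiranoSum.

(* An alias of [A], so that ring instances do not have to join the normed ones. *)
Definition balg (R : realType) (A : completeNormedModType R[i])
  (mul : A -> A -> A) (one : A) (HA : is_banach_algebra mul one) : Type := A.

(** * Transfer to the explicitly given Banach algebra *)

Section BanachAlgebraStructure.
Variables (R : realType) (A : completeNormedModType R[i])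
  (mul : A -> A -> A) (one : A) (HA : is_banach_algebra mul one).
Local Notation B := (@balg R A mul one HA).

HB.instance Definition _ := GRing.Lmodule.copy B A.
HB.instance Definition _ := GRing.Zmodule_isNzRing.Build B
  (ba_mulA HA) (ba_mul1l HA) (ba_mul1r HA) (ba_mulDl HA) (ba_mulDr HA)
  (ba_one_neq0 HA).
HB.instance Definition _ := GRing.Lmodule_isLalgebra.Build _ B
  (fun c x y => esym (ba_mulZl HA c x y)).
HB.instance Definition _ := GRing.Lalgebra_isAlgebra.Build _ B
  (fun c x y => esym (ba_mulZr HA c x y)).

(** The norm of [A] takes values in [R[i]]; these are nonnegative, hence real, so the real part
    loses nothing. *)
Definition renorm (x : B) : R := complex.Re (`|x : A|).

Lemma renormE (x : B) : `|x : A| = (renorm x)%:C.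
Proof. by rewrite /renorm RRe_real // ger0_real. Qed.

Lemma renorm_banach : banach_norm renorm.
Proof.
split.
- by move=> x y; rewrite -lecR rmorphD /= -!renormE; exact: (@ler_normD _ A x y).
- by move=> x y; rewrite -lecR rmorphM /= -!renormE; exact: (ba_normM HA x y).
- by move=> c x; apply: complexI; rewrite rmorphM /= -!renormE; rewrite (@normrZ _ A c x) normc_def; case: c.
- by move=> x /(congr1 (fun r : R => r%:C)); rewrite -renormE => /eqP; rewrite normr_eq0 => /eqP.
- move=> u hu.
  have cu : cvg ((u : nat -> A) @ \oo)%classic.
    apply/cauchy_cvgP/cauchy_exP => e e0.
    have [e1 eE] : exists e1 : R, e = e1%:C.
      by exists (complex.Re e); rewrite RRe_real // gtr0_real.
    rewrite eE ltcR in e0; have [N hN] := hu _ e0.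
    exists (u N), N => // n /= Nn; rewrite -ball_normE /= eE.
    by have := hN _ _ (leqnn N) Nn; rewrite -ltcR -renormE.
  exists (lim ((u : nat -> A) @ \oo)%classic) => e e0.
  have /cvgrPdist_lt/(_ (e%:C)) := cu.
  rewrite ltcR => /(_ e0) [N _ hN]; exists N => n Nn; have := hN n Nn.
  by rewrite distrC /= => h; rewrite -ltcR -renormE.
Qed.

Lemma ba_invertibleE (x : B) : ba_invertible mul one x <-> invertible x.
Proof. by split=> [[y [h1 h2]]|[y h1 h2]]; exists y. Qed.

Lemma ba_powE (x : B) n : ba_pow mul one x n = x ^+ n.
Proof. by elim: n => [//|n IH]; rewrite exprS -IH. Qed.

(** For nonzero mu, 1 - mu x is mu times 1/mu - x, so [qnil] says that no nonzero value is spectral;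
    that 0 is spectral comes from [qnil_not_invertible]. *)
Lemma ba_qnilE (x : B) : ba_qnil mul one x <-> qnil x.
Proof.
split=> [h mu|h].
  have [->|mu0] := eqVneq mu 0; first by rewrite scale0r subr0; exact: invertible1.
  have -> : 1 - mu *: x = mu%:A * ((mu^-1)%:A - x).
    by rewrite mulrBr -!scalerAl !mul1r scalerA mulfV // scale1r.
  apply: invertibleM; first exact: invertible_alg.
  apply/ba_invertibleE; apply: contrapT => hn.
  have : ba_spectrum mul one x mu^-1 by exact: hn.
  by rewrite h /= => /eqP; rewrite invr_eq0 (negPf mu0).
apply/seteqP; split=> lam /=.
  move=> hl; apply: contrapT => /eqP l0; apply: hl; apply/ba_invertibleE.
  exact: qnil_shift_invertible.
move=> -> /ba_invertibleE; rewrite scale0r sub0r => hx.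
apply: (qnil_not_invertible renorm_banach h).
have -> : x = (-1)%:A * - x by rewrite -scalerAl mul1r scaleN1r opprK.
by apply: invertibleM => //; apply: invertible_alg; rewrite oppr_eq0 oner_eq0.
Qed.

Lemma gpiHiranoE (x : B) : gpiHirano mul one x <-> hirano x.
Proof.
by split=> -[y [h1 h2 [n [n0 h3]]]]; exists y; split => //; exists n; split => //;
  [apply/ba_qnilE | apply/ba_qnilE]; move: h3; rewrite ba_powE.
Qed.
End BanachAlgebraStructure.

Theorem theorem3p4 (R : realType) (A : completeNormedModType R[i])
  (mul : A -> A -> A) (one : A) (HA : is_banach_algebra mul one)
  (a b : A) (k : nat) :
  (0 < k)%N ->
  (forall alpha : 'I_k -> A, (forall j, alpha j = a \/ alpha j = b) ->
     mul (mul (\big[mul/one]_(j < k) alpha j) a) b = 0) ->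
  ((gpiHirano mul one a /\ gpiHirano mul one b) <-> gpiHirano mul one (a + b)).
Proof.
move=> _ hab; have E x := @gpiHiranoE _ _ _ _ HA x.
have [] := @hirano_sum _ _ _ (renorm_banach HA) a b k.
  (* The word becomes the family of its entries indexed by ['I_k]; the default 0 is never read, as
     all indices are below [size s]. *)
  move=> s sk hs; rewrite (big_nth 0) big_mkord sk.
  by apply: hab => j; apply/hs/mem_nth; rewrite sk.
move=> h1 h2; split=> [[/E ha /E hb]|/E hc]; first exact/E/h1.
by have [ha hb] := h2 hc; split; apply/E.
Qed.
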